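(* For every positive integer $k$ there exists a planar graph $G$ of odd-girth $2k+1$ such that $\omega\big(G^{(2k-1)}\big)\geq 2^{2k}$.
   Context: All graphs are finite. The odd-girth of a graph is the length of a shortest odd cycle in it. For a graph $G$ and a positive integer $m$, the $m$-th walk-power $G^{(m)}$ is the graph with vertex set $V(G)$ in which two distinct vertices $x,y$ are adjacent if and only if there is a walk of length exactly $m$ in $G$ connecting $x$ and $y$. $\omega(H)$ denotes the clique number of a graph $H$. *)

(* Defs.v *)
From mathcomp Require Import all_boot all_order all_algebra.
From mathcomp Require Import all_classical all_reals all_analysis.
From mathcomp Require Import Rstruct Rstruct_topology.
From Stdlib Require Import Rdefinitions.
Set Implicit Arguments.
Unset Strict Implicit.
Unset Printing Implicit Defensive.
Import Order.TTheory GRing.Theory Num.Theory.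

Definition simple_graph (T : finType) (e : rel T) : Prop :=
  symmetric e /\ irreflexive e.

Definition is_cycle (T : finType) (e : rel T) (c : seq T) : bool :=
  [&& (2 < size c)%N, uniq c & cycle e c].

Definition has_odd_girth (T : finType) (e : rel T) (g : nat) : Prop :=
  odd g /\ (exists c, is_cycle e c /\ size c = g) /\
  (forall c, is_cycle e c -> odd (size c) -> (g <= size c)%N).

Definition walk_of_length (T : finType) (e : rel T) (m : nat) (x y : T) : bool :=
  [exists s : m.-tuple T, path e x s && (last x s == y)].

Definition walk_power (T : finType) (e : rel T) (m : nat) : rel T :=
  fun x y => (x != y) && walk_of_length e m x y.

Definition is_clique (T : finType) (e : rel T) (K : {set T}) : bool :=
  [forall x in K, forall y in K, (x != y) ==> e x y].

Definition clique_number (T : finType) (e : rel T) : nat :=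
  \max_(K : {set T} | is_clique e K) #|K|.

Local Open Scope classical_set_scope.
Local Open Scope ring_scope.

(* Planarity: a drawing in the real plane R x R where vertices are distinct
   points and each edge xy is a simple arc (continuous, injective on [0,1])
   from x to y whose interior avoids all vertices, and interiors of arcs of
   distinct edges are disjoint.  arc x y and arc y x represent the same
   (undirected) edge, so no condition relates them. *)
Definition planar (T : finType) (e : rel T) : Prop :=
  exists (p : T -> R * R) (arc : T -> T -> R -> R * R),
    injective p /\
    (forall x y, e x y ->
       {within `[0, 1], continuous (arc x y)} /\
       {in `[0, 1] &, injective (arc x y)} /\
       arc x y 0 = p x /\ arc x y 1 = p y) /\
    (forall x y, e x y -> forall t, 0 < t < 1 -> forall v, arc x y t <> p v) /\
    (forall x y u v, e x y -> e u v ->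
       ~ ((x = u /\ y = v) \/ (x = v /\ y = u)) ->
       forall s t, 0 < s < 1 -> 0 < t < 1 -> arc x y s <> arc u v t).

(* Main.v *)
Require Import Defs.
From Stdlib Require Import Rdefinitions.
From mathcomp Require Import Rstruct Rstruct_topology.
From mathcomp Require Import all_boot all_order all_algebra.
From mathcomp Require Import zify lra.
From mathcomp Require Import all_classical all_reals all_analysis.
Set Implicit Arguments.
Unset Strict Implicit.
Unset Printing Implicit Defensive.
Import Order.TTheory GRing.Theory Num.Theory numFieldNormedType.Exports.

(** Start from two parallel edges joining two poles, one plain and one special.
    Repeat the following step 2k - 1 times, n being the current odd girth
    (n = 2 at the start): replace each special edge x -- y by a 4-cycle
    x, c_r, y, c_0 with r = n - 1, in which x -- c_0 and c_r -- y are special,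
    and join c_0 to c_r inside it by a plain path of length r.  Every odd cycle
    of the final graph has length at least 2k + 1, because the graph maps to
    the projective cube: a plain edge flips one of 2k coordinates and a special
    edge flips all of them.  The 2^(2k-1) special edges are pairwise disjoint
    and their 2^(2k) ends form the clique.  Indeed, two special edges x0 -- x1
    and y0 -- y1 descend from the two special edges of a common 4-cycle, and
    routing through the corners of that 4-cycle bounds the four plain distances
    between x_i and y_j well enough that, possibly after adding one or two
    special edges, some route is odd and of length at most 2k - 1. *)

(** * The recursive step on graphs with two poles *)

Definition src {I : finType} : bool + I := inl false.
Definition snk {I : finType} : bool + I := inl true.

(* The vertices added by one step, apart from the two poles: the path
   [diag 0], ..., [diag r] and the inner vertices of two copies of the graph,
   [lft] joining [src] to [diag 0] and [rgt] joining [diag r] to [snk]. *)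
Definition inner (r : nat) (I : finType) : finType := ('I_r.+1 + (I + I))%type.

(** Meaningful for [i <= r] only: beyond that, [inord] falls back to 0. *)
Definition diag r (I : finType) (i : nat) : bool + inner r I := inr (inl (inord i)).

Definition lft r (I : finType) (v : bool + I) : bool + inner r I :=
  match v with
  | inl false => src
  | inl true => diag r I 0
  | inr i => inr (inr (inl i))
  end.

Definition rgt r (I : finType) (v : bool + I) : bool + inner r I :=
  match v with
  | inl false => diag r I r
  | inl true => snk
  | inr i => inr (inr (inr i))
  end.

(** The recursion runs from the outside in: the special edges of the outer 4-cycle become whole
    copies of the previous graph. Edges are directed, from left to right in the drawing below;
    [close_poles] symmetrizes at the end. *)
Definition blowup r (I : finType) (d : rel (bool + I)) : rel (bool + inner r I) :=
  fun u v =>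
  [|| [exists a, exists b, [&& d a b, u == lft r a & v == lft r b]],
      [exists a, exists b, [&& d a b, u == rgt r a & v == rgt r b]],
      (u == src) && (v == diag r I r),
      (u == diag r I 0) && (v == snk)
    | [exists i : 'I_r, (u == diag r I i) && (v == diag r I i.+1)]].

Variant blowup_spec r (I : finType) (d : rel (bool + I)) :
    bool + inner r I -> bool + inner r I -> Prop :=
| BlowupLft a b of d a b : blowup_spec d (lft r a) (lft r b)
| BlowupRgt a b of d a b : blowup_spec d (rgt r a) (rgt r b)
| BlowupSrc : blowup_spec d src (diag r I r)
| BlowupSnk : blowup_spec d (diag r I 0) snk
| BlowupDiag i of i < r : blowup_spec d (diag r I i) (diag r I i.+1).

Lemma blowupP r (I : finType) (d : rel (bool + I)) u v :
  reflect (blowup_spec d u v) (blowup (r := r) d u v).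
Proof.
apply: (iffP idP) => [|[a b dab|a b dab|||i ir]]; last first.
- by apply/or4P; apply: Or44; apply/orP; right; apply/existsP;
    exists (Ordinal ir); rewrite /= !eqxx.
- by rewrite /blowup !eqxx !orbT.
- by rewrite /blowup !eqxx !orbT.
- by apply/or4P; apply: Or42; apply/existsP; exists a; apply/existsP; exists b;
    rewrite dab !eqxx.
- by apply/or4P; apply: Or41; apply/existsP; exists a; apply/existsP; exists b;
    rewrite dab !eqxx.
case/or4P => [||/andP[/eqP-> /eqP->]|/orP[/andP[/eqP-> /eqP->]|]].
- by case/existsP=> a /existsP[b /and3P[dab /eqP-> /eqP->]]; apply: BlowupLft.
- by case/existsP=> a /existsP[b /and3P[dab /eqP-> /eqP->]]; apply: BlowupRgt.
- exact: BlowupSrc.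
- exact: BlowupSnk.
by case/existsP=> i /andP[/eqP-> /eqP->]; apply: BlowupDiag.
Qed.

(** The cases overlap at the corners ([diag 0] is the sink of the left copy, [diag r] the source of
    the right one), so the poles of a copy need no separate treatment. *)
Variant vertex_spec r (I : finType) : bool + inner r I -> Prop :=
| VertexLft a : vertex_spec (lft r a)
| VertexRgt a : vertex_spec (rgt r a)
| VertexDiag i of i <= r : vertex_spec (diag r I i).

Lemma vertexP r (I : finType) (v : bool + inner r I) : vertex_spec v.
Proof.
case: v => [[]|[i|[i|i]]].
- exact: (VertexRgt r snk).
- exact: (VertexLft r src).
- by rewrite -[i]inord_val; apply: VertexDiag; rewrite -ltnS.
- exact: (VertexLft r (inr i)).
- exact: (VertexRgt r (inr i)).
Qed.

(** * Straight-line drawings *)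

Section Drawing.
Local Open Scope ring_scope.

Definition seg (R : realFieldType) (a b t : R) : R := (1 - t) * a + t * b.

(* A straight-line drawing in the rhombus with diagonal from (0, 0) to (1, 0),
   all edges going from left to right. *)
Record drawing (R : realFieldType) (I : finType) (d : rel (bool + I))
    (X Y : bool + I -> R) : Prop := Drawing {
  drawing_src : X src = 0 /\ Y src = 0;
  drawing_snk : X snk = 1 /\ Y snk = 0;
  drawing_rhombus : forall v, `|Y v| <= X v /\ `|Y v| <= 1 - X v;
  drawing_inj : forall u v, X u = X v -> Y u = Y v -> u = v;
  drawing_mono : forall u v, d u v -> X u < X v;
  drawing_avoid : forall u v w t, d u v -> 0 < t < 1 ->
    seg (X u) (X v) t = X w -> seg (Y u) (Y v) t = Y w -> False;
  drawing_noncross : forall u v u' v' s t, d u v -> d u' v' ->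
    0 < s < 1 -> 0 < t < 1 ->
    seg (X u) (X v) s = seg (X u') (X v') t ->
    seg (Y u) (Y v) s = seg (Y u') (Y v') t -> u = u' /\ v = v'
}.

(** The rhombus is convex; strictness comes from the abscissa increasing along an edge. *)
Lemma drawing_edge (R : realFieldType) (I : finType) (d : rel (bool + I))
    (X Y : bool + I -> R) u v t :
  drawing d X Y -> d u v -> 0 < t < 1 ->
  [/\ 0 < seg (X u) (X v) t < 1,
      `|seg (Y u) (Y v) t| <= seg (X u) (X v) t
    & `|seg (Y u) (Y v) t| <= 1 - seg (X u) (X v) t].
Proof.
move=> D duv /andP[t0 t1]; have Xuv := drawing_mono D duv.
have [] := drawing_rhombus D u; have [] := drawing_rhombus D v.
rewrite !ler_norml => /andP[v1 v2] /andP[v3 v4] /andP[u1 u2] /andP[u3 u4].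
rewrite /seg; split.
- have : 0 < t * (X v - X u) by rewrite mulr_gt0 ?subr_gt0.
  have : 0 < (1 - t) * (X v - X u) by rewrite mulr_gt0 ?subr_gt0.
  by move=> h1 h2; apply/andP; split; lra.
- have a1 : 0 <= (1 - t) * (X u - Y u) by rewrite mulr_ge0; lra.
  have a2 : 0 <= (1 - t) * (X u + Y u) by rewrite mulr_ge0; lra.
  have a3 : 0 <= t * (X v - Y v) by rewrite mulr_ge0; lra.
  have a4 : 0 <= t * (X v + Y v) by rewrite mulr_ge0; lra.
  by apply/andP; split; lra.
- have a1 : 0 <= (1 - t) * (1 - X u - Y u) by rewrite mulr_ge0; lra.
  have a2 : 0 <= (1 - t) * (1 - X u + Y u) by rewrite mulr_ge0; lra.
  have a3 : 0 <= t * (1 - X v - Y v) by rewrite mulr_ge0; lra.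
  have a4 : 0 <= t * (1 - X v + Y v) by rewrite mulr_ge0; lra.
  by apply/andP; split; lra.
Qed.

Lemma drawing_edge_graph (R : realFieldType) :
  drawing (fun u v : bool + void => (u == src) && (v == snk))
    (fun v => (v == snk)%:R : R) (fun=> 0).
Proof.
split=> [||v|u v|u v|u v w t|u v u' v' s t].
- by [].
- by [].
- by rewrite normr0; case: (v == snk) => /=; split; lra.
- by move=> uv _; case: u uv => [[]|[]]; case: v => [[]|[]] //= /eqP;
    rewrite ?oner_eq0 // eq_sym oner_eq0.
- by move=> /andP[/eqP-> /eqP->] /=; exact: ltr01.
- move=> /andP[/eqP-> /eqP->] /= /andP[t0 t1]; rewrite /seg /=.
  by case: (w == snk) => /= ? _; lra.
by move=> /andP[/eqP-> /eqP->] /andP[/eqP-> /eqP->].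
Qed.

(* The path [diag] lies on the segment from (1/4, 1/8) to (3/4, -1/8).  The
   copies are the images of the old drawing under the shear
   (x, y) |-> (x/4, x/8 + y/16) and its translate by (3/4, -1/8), hence lie over
   the disjoint intervals [0, 1/4] and [3/4, 1]. *)
Definition blowupX (R : realFieldType) r (I : finType) (X : bool + I -> R)
    (v : bool + inner r I) : R :=
  match v with
  | inl b => b%:R
  | inr (inl i) => 1 / 4 + i%:R / r%:R / 2
  | inr (inr (inl i)) => X (inr i) / 4
  | inr (inr (inr i)) => 3 / 4 + X (inr i) / 4
  end.

Definition blowupY (R : realFieldType) r (I : finType) (X Y : bool + I -> R)
    (v : bool + inner r I) : R :=
  match v with
  | inl b => 0
  | inr (inl i) => 1 / 8 - i%:R / r%:R / 4
  | inr (inr (inl i)) => X (inr i) / 8 + Y (inr i) / 16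
  | inr (inr (inr i)) => - (1 / 8) + X (inr i) / 8 + Y (inr i) / 16
  end.

Lemma blowupX_diag (R : realFieldType) r (I : finType) (X : bool + I -> R) i :
  (i <= r)%N -> blowupX X (diag r I i) = 1 / 4 + i%:R / r%:R / 2.
Proof. by move=> ir; rewrite /= inordK. Qed.

Lemma blowupY_diag (R : realFieldType) r (I : finType) (X Y : bool + I -> R) i :
  (i <= r)%N -> blowupY X Y (diag r I i) = 1 / 8 - i%:R / r%:R / 4.
Proof. by move=> ir; rewrite /= inordK. Qed.

(** The shear sends (1, 0) to (1/4, 1/8), where [diag 0] is placed, so its formula holds at the
    poles of the copy too. *)
Lemma blowup_lft (R : realFieldType) r (I : finType) (d : rel (bool + I))
    (X Y : bool + I -> R) a : drawing d X Y ->
  blowupX X (lft r a) = X a / 4 /\ blowupY X Y (lft r a) = X a / 8 + Y a / 16.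
Proof.
move=> D; have [Xs Ys] := drawing_src D; have [Xt Yt] := drawing_snk D.
case: a => [[]|i] //.
  have -> : lft r (inl true) = diag r I 0 by [].
  rewrite blowupX_diag // blowupY_diag // mul0r Xt Yt; split; lra.
by rewrite /= Xs Ys; split; lra.
Qed.

Lemma blowup_rgt (R : realFieldType) r (I : finType) (d : rel (bool + I))
    (X Y : bool + I -> R) a : (0 < r)%N -> drawing d X Y ->
  blowupX X (rgt r a) = 3 / 4 + X a / 4 /\
  blowupY X Y (rgt r a) = - (1 / 8) + X a / 8 + Y a / 16.
Proof.
move=> r0 D; have [Xs Ys] := drawing_src D; have [Xt Yt] := drawing_snk D.
case: a => [[]|i] //.
  by rewrite /= Xt Yt; split; lra.
have -> : rgt r (inl false) = diag r I r by [].
rewrite blowupX_diag // blowupY_diag // divff ?pnatr_eq0 ?lt0n_neq0 // Xs Ys.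
by split; lra.
Qed.

(** Each copy keeps one side of its rhombus only: [- x <= y] puts the left copy strictly above the
    axis, away from the edge [src] -- [diag r], and [y <= 1 - x] puts the right copy strictly below
    it, away from [diag 0] -- [snk]. *)
Variant edge_zone (R : realFieldType) r (I : finType) (d : rel (bool + I))
    (X Y : bool + I -> R) (t : R) :
    bool + inner r I -> bool + inner r I -> R -> R -> Prop :=
| ZoneLft a b of d a b
    & 0 < seg (X a) (X b) t < 1
    & - seg (X a) (X b) t <= seg (Y a) (Y b) t :
    edge_zone d X Y t (lft r a) (lft r b)
      (seg (X a) (X b) t / 4)
      (seg (X a) (X b) t / 8 + seg (Y a) (Y b) t / 16)
| ZoneRgt a b of d a b
    & 0 < seg (X a) (X b) t < 1
    & seg (Y a) (Y b) t <= 1 - seg (X a) (X b) t :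
    edge_zone d X Y t (rgt r a) (rgt r b)
      (3 / 4 + seg (X a) (X b) t / 4)
      (- (1 / 8) + seg (X a) (X b) t / 8 + seg (Y a) (Y b) t / 16)
| ZoneSrc : edge_zone d X Y t src (diag r I r) (t * (3 / 4)) (- t / 8)
| ZoneSnk : edge_zone d X Y t (diag r I 0) snk (1 / 4 + t * (3 / 4)) ((1 - t) / 8)
| ZoneDiag i of (i < r)%N :
    edge_zone d X Y t (diag r I i) (diag r I i.+1)
      (1 / 4 + (i%:R + t) / r%:R / 2) (1 / 8 - (i%:R + t) / r%:R / 4).

Lemma blowup_zone (R : realFieldType) r (I : finType) (d : rel (bool + I))
    (X Y : bool + I -> R) u v t :
  (0 < r)%N -> drawing d X Y -> blowup (r := r) d u v -> 0 < t < 1 ->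
  edge_zone d X Y t u v (seg (blowupX X u) (blowupX X v) t)
    (seg (blowupY X Y u) (blowupY X Y v) t).
Proof.
move=> r0 D /blowupP duv t01.
case: duv => [a b dab|a b dab|||i ir].
- have [x01] := drawing_edge D dab t01.
  rewrite ler_norml => /andP[y1 _] _.
  have [-> ->] := blowup_lft r a D; have [-> ->] := blowup_lft r b D.
  have -> : seg (X a / 4) (X b / 4) t = seg (X a) (X b) t / 4.
    by clear; rewrite /seg; lra.
  have -> : seg (X a / 8 + Y a / 16) (X b / 8 + Y b / 16) t =
      seg (X a) (X b) t / 8 + seg (Y a) (Y b) t / 16.
    by clear; rewrite /seg; lra.
  exact: ZoneLft.
- have [x01 _] := drawing_edge D dab t01.
  rewrite ler_norml => /andP[_ y1].
  have [-> ->] := blowup_rgt a r0 D; have [-> ->] := blowup_rgt b r0 D.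
  have -> : seg (3 / 4 + X a / 4) (3 / 4 + X b / 4) t =
      3 / 4 + seg (X a) (X b) t / 4.
    by clear; rewrite /seg; lra.
  have -> : seg (- (1 / 8) + X a / 8 + Y a / 16) (- (1 / 8) + X b / 8 + Y b / 16) t =
      - (1 / 8) + seg (X a) (X b) t / 8 + seg (Y a) (Y b) t / 16.
    by clear; rewrite /seg; lra.
  exact: ZoneRgt.
- rewrite blowupX_diag // blowupY_diag // divff ?pnatr_eq0 ?lt0n_neq0 // /seg /=.
  have -> : (1 - t) * 0 + t * (1 / 4 + 1 / 2) = t * (3 / 4) by clear; lra.
  have -> : (1 - t) * 0 + t * (1 / 8 - 1 / 4) = - t / 8 by clear; lra.
  exact: ZoneSrc.
- rewrite blowupX_diag // blowupY_diag // mul0r /seg /=.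
  have -> : (1 - t) * (1 / 4 + 0 / 2) + t * 1 = 1 / 4 + t * (3 / 4).
    by clear; lra.
  have -> : (1 - t) * (1 / 8 - 0 / 4) + t * 0 = (1 - t) / 8 by clear; lra.
  exact: ZoneSnk.
- rewrite !blowupX_diag ?blowupY_diag ?(ltnW ir) //.
  have -> : seg (1 / 4 + i%:R / r%:R / 2) (1 / 4 + i.+1%:R / r%:R / 2) t =
      1 / 4 + (i%:R + t) / r%:R / 2.
    rewrite -[i.+1%:R]natr1 /seg; move: (i%:R) (r%:R^-1) => p q; clear; lra.
  have -> : seg (1 / 8 - i%:R / r%:R / 4) (1 / 8 - i.+1%:R / r%:R / 4) t =
      1 / 8 - (i%:R + t) / r%:R / 4.
    rewrite -[i.+1%:R]natr1 /seg; move: (i%:R) (r%:R^-1) => p q; clear; lra.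
  exact: ZoneDiag.
Qed.

Lemma diag_param01 (R : realFieldType) r i (t : R) :
  (i < r)%N -> 0 < t < 1 -> 0 < (i%:R + t) / r%:R < 1.
Proof.
move=> ir /andP[t0 t1].
have rR : (0 : R) < r%:R by rewrite ltr0n (leq_ltn_trans _ ir).
have ir' : i.+1%:R <= r%:R :> R by rewrite ler_nat.
have i0 : 0 <= i%:R :> R by [].
rewrite ltr_pdivrMr // mul1r divr_gt0 //=.
  by move: ir'; rewrite -natr1 => ir'; lra.
by move: (i%:R) i0 t0 => p; clear; lra.
Qed.

(** Both indices are the integer part of the common value. *)
Lemma diag_index (R : realFieldType) (i j : nat) (s t : R) :
  0 <= s < 1 -> 0 <= t < 1 -> i%:R + s = j%:R + t -> i = j.
Proof.
move=> /andP[s0 s1] /andP[t0 t1] e; apply/eqP.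
rewrite eqn_leq -(ltnS i j) -(ltnS j i) -!(ltr_nat R) -!natr1.
by apply/andP; split; lra.
Qed.

Lemma diag_bounds (R : realFieldType) r i :
  (i <= r)%N -> 0 <= (i%:R / r%:R : R) <= 1.
Proof.
(* For [r = 0] the quotient is 0, as the inverse of 0 is 0. *)
case: r => [|r] ir; first by rewrite invr0 mulr0 lexx ler01.
by rewrite divr_ge0 ?ler0n // ler_pdivrMr ?ltr0n // mul1r ler_nat.
Qed.

Lemma drawing_cone (R : realFieldType) (I : finType) (d : rel (bool + I))
    (X Y : bool + I -> R) v : drawing d X Y ->
  [/\ - X v <= Y v, Y v <= X v, X v - 1 <= Y v & Y v <= 1 - X v].
Proof.
case/drawing_rhombus/(_ v); rewrite !ler_norml => /andP[? ?] /andP[? ?].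
by split; lra.
Qed.

(** The copies have abscissae at most 1/4 and at least 3/4, the path those in between; so different
    kinds can meet only at [diag 0] and [diag r], where the vertices are the same. *)
Lemma blowup_inj (R : realFieldType) r (I : finType) (d : rel (bool + I))
    (X Y : bool + I -> R) (u v : bool + inner r I) :
  (0 < r)%N -> drawing d X Y ->
  blowupX X u = blowupX X v -> blowupY X Y u = blowupY X Y v -> u = v.
Proof.
move=> r0 D; have rR : (r%:R : R) != 0 by rewrite pnatr_eq0 -lt0n.
have LD a i : (i <= r)%N -> X a / 4 = 1 / 4 + i%:R / r%:R / 2 ->
    X a / 8 + Y a / 16 = 1 / 8 - i%:R / r%:R / 4 -> lft r a = diag r I i.
  move=> ir; have [a1 a2 a3 a4] := drawing_cone a D.
  have [Xt Yt] := drawing_snk D.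
  have /andP[] := diag_bounds R ir; case: i ir => [|i] ir q0 q1 hX hY.
    rewrite (drawing_inj D (u := a) (v := snk)) // ?Xt ?Yt //.
      by move: hX; rewrite mul0r; clear; lra.
    by move: hX hY; rewrite mul0r; clear; lra.
  have qp : (0 : R) < i.+1%:R / r%:R by rewrite divr_gt0 ?ltr0n.
  exfalso; move: qp hX a1 a2 a3 a4; move: (_ / r%:R) => q; clear; lra.
have RD a i : (i <= r)%N -> 3 / 4 + X a / 4 = 1 / 4 + i%:R / r%:R / 2 ->
    - (1 / 8) + X a / 8 + Y a / 16 = 1 / 8 - i%:R / r%:R / 4 -> rgt r a = diag r I i.
  move=> ir; have [a1 a2 a3 a4] := drawing_cone a D.
  have [Xs Ys] := drawing_src D.
  have /andP[q0 q1] := diag_bounds R ir => hX hY.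
  have q : i%:R / r%:R = 1 :> R.
    by move: (i%:R / r%:R) hX a1 a2 q1 => q; clear; lra.
  have -> : i = r by apply/eqP; rewrite -(eqr_nat R) -[i%:R](mulfVK rR) q mul1r.
  rewrite (drawing_inj D (u := a) (v := src)) // ?Xs ?Ys //.
    by move: hX; rewrite q; clear; lra.
  by move: hX hY; rewrite q; clear; lra.
case: {u}(vertexP u) => [a|a|i ir]; case: {v}(vertexP v) => [b|b|j jr].
- have [-> ->] := blowup_lft r a D; have [-> ->] := blowup_lft r b D => hX hY.
  by rewrite (drawing_inj D (u := a) (v := b)) //; move: hX hY; clear; lra.
- have [-> _] := blowup_lft r a D; have [-> _] := blowup_rgt b r0 D.
  have [a1 a2 a3 a4] := drawing_cone a D; have [b1 b2 b3 b4] := drawing_cone b D.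
  by move=> hX _; exfalso; move: hX a1 a2 a3 a4 b1 b2 b3 b4; clear; lra.
- have [-> ->] := blowup_lft r a D; rewrite blowupX_diag // blowupY_diag //.
  exact: LD.
- have [-> _] := blowup_lft r b D; have [-> _] := blowup_rgt a r0 D.
  have [a1 a2 a3 a4] := drawing_cone a D; have [b1 b2 b3 b4] := drawing_cone b D.
  by move=> hX _; exfalso; move: hX a1 a2 a3 a4 b1 b2 b3 b4; clear; lra.
- have [-> ->] := blowup_rgt a r0 D; have [-> ->] := blowup_rgt b r0 D => hX hY.
  by rewrite (drawing_inj D (u := a) (v := b)) //; move: hX hY; clear; lra.
- have [-> ->] := blowup_rgt a r0 D; rewrite blowupX_diag // blowupY_diag //.
  exact: RD.
- have [-> ->] := blowup_lft r b D; rewrite blowupX_diag // blowupY_diag //.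
  by move=> hX hY; apply/esym/LD.
- have [-> ->] := blowup_rgt b r0 D; rewrite blowupX_diag // blowupY_diag //.
  by move=> hX hY; apply/esym/RD.
- rewrite !blowupX_diag // => hX _; congr diag; apply/eqP.
  rewrite -(eqr_nat R) -[i%:R](mulfVK rR) -[j%:R](mulfVK rR).
  by have -> : i%:R / r%:R = j%:R / r%:R :> R by move: hX; clear; lra.
Qed.

Lemma drawing_blowup (R : realFieldType) r (I : finType) (d : rel (bool + I))
    (X Y : bool + I -> R) :
  (0 < r)%N -> drawing d X Y ->
  drawing (blowup (r := r) d) (blowupX (r := r) X) (blowupY (r := r) X Y).
Proof.
move=> r0 D; have rR : (r%:R : R) != 0 by rewrite pnatr_eq0 -lt0n.
have rV : (r%:R : R)^-1 != 0 by rewrite invr_eq0.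
split=> [||v|u v|u v duv|u v w t duv t01|u v u' v' s t duv duv' s01 t01].
- by [].
- by [].
- case: {v}(vertexP v) => [a|a|i ir].
  + have [-> ->] := blowup_lft r a D; have [] := drawing_cone a D.
    by clear; rewrite !ler_norml => *; split; apply/andP; split; lra.
  + have [-> ->] := blowup_rgt a r0 D; have [] := drawing_cone a D.
    by clear; rewrite !ler_norml => *; split; apply/andP; split; lra.
  + rewrite blowupX_diag // blowupY_diag //; have /andP[] := diag_bounds R ir.
    move: (i%:R / r%:R) => q; clear => *.
    by rewrite !ler_norml; split; apply/andP; split; lra.
- exact: blowup_inj D.
- case/blowupP: duv => [a b /(drawing_mono D)|a b /(drawing_mono D)|||i ir].
  + have [-> _] := blowup_lft r a D; have [-> _] := blowup_lft r b D.
    by clear; lra.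
  + have [-> _] := blowup_rgt a r0 D; have [-> _] := blowup_rgt b r0 D.
    by clear; lra.
  + by rewrite blowupX_diag // divff //=; clear; lra.
  + by rewrite blowupX_diag // mul0r /=; clear; lra.
  + have h2 : (0 : R) < 2^-1 by clear; lra.
    have hr : (0 : R) < r%:R^-1 by rewrite invr_gt0 ltr0n.
    rewrite !blowupX_diag ?(ltnW ir) // ltrD2l (ltr_pM2r h2) (ltr_pM2r hr).
    by rewrite ltr_nat.
- have /andP[t0 t1] := t01; case: (blowup_zone r0 D duv t01)
    => [a b dab /andP[x0 x1] y0|a b dab /andP[x0 x1] y0|||i ir];
    case: {w}(vertexP w) => [c|c|k kr].
  + have [-> ->] := blowup_lft r c D => hX hY.
    by apply: (drawing_avoid D dab t01 (w := c)); move: hX hY; clear; lra.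
  + have [-> _] := blowup_rgt c r0 D; have [c1 c2 c3 c4] := drawing_cone c D.
    by move: x1 c1 c2; clear; lra.
  + rewrite blowupX_diag //; have /andP[q0 _] := diag_bounds R kr.
    by move: x1 q0; clear; lra.
  + have [-> _] := blowup_lft r c D; have [c1 c2 c3 c4] := drawing_cone c D.
    by move: x0 c3 c4; clear; lra.
  + have [-> ->] := blowup_rgt c r0 D => hX hY.
    by apply: (drawing_avoid D dab t01 (w := c)); move: hX hY; clear; lra.
  + rewrite blowupX_diag //; have /andP[_ q1] := diag_bounds R kr.
    by move: x0 q1; clear; lra.
  + have [-> ->] := blowup_lft r c D; have [c1 c2 c3 c4] := drawing_cone c D.
    by move: t0 c1 c2; clear; lra.
  + have [-> _] := blowup_rgt c r0 D; have [c1 c2 c3 c4] := drawing_cone c D.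
    by move: t1 c1 c2; clear; lra.
  + rewrite blowupX_diag // blowupY_diag //.
    by move: (_ / r%:R) t1 => q; clear; lra.
  + have [-> _] := blowup_lft r c D; have [c1 c2 c3 c4] := drawing_cone c D.
    by move: t0 c3 c4; clear; lra.
  + have [-> ->] := blowup_rgt c r0 D; have [c1 c2 c3 c4] := drawing_cone c D.
    by move: t1 c3 c4; clear; lra.
  + rewrite blowupX_diag // blowupY_diag //.
    by move: (_ / r%:R) t0 => q; clear; lra.
  + have [-> _] := blowup_lft r c D; have [c1 c2 c3 c4] := drawing_cone c D.
    have /andP[q0 _] := diag_param01 ir t01.
    by move: (_ / r%:R) q0 c3 c4 => q; clear; lra.
  + have [-> _] := blowup_rgt c r0 D; have [c1 c2 c3 c4] := drawing_cone c D.
    have /andP[_ q1] := diag_param01 ir t01.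
    by move: (_ / r%:R) q1 c1 c2 => q; clear; lra.
  + rewrite blowupX_diag // => hX _.
    (* A vertex of the path is a point with offset 0. *)
    have e : i%:R + t = k%:R + 0.
      by apply: (mulIf rV); rewrite addr0; move: hX; clear; lra.
    have ik : i = k by apply: diag_index e; rewrite ?lexx ?ltr01 ?(ltW t0).
    by move: e t0; rewrite ik; clear; lra.
(* Two edges of one copy reduce to the old drawing, two path edges to integer parts. The path lies
   on the line x + 2y = 1/2, with the interiors of the two plain sides strictly on either side of
   it. The other pairs differ in abscissa or in the sign of the ordinate. *)
- have /andP[s0 s1] := s01; have /andP[t0 t1] := t01.
  case: (blowup_zone r0 D duv s01)
    => [a b dab /andP[x0 x1] y0|a b dab /andP[x0 x1] y0|||i ir];
  case: (blowup_zone r0 D duv' t01)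
    => [a' b' dab' /andP[z0 z1] w0|a' b' dab' /andP[z0 z1] w0|||k kr].
  + move=> hX hY; have [||-> ->] := drawing_noncross D dab dab' s01 t01; last by [].
      by move: hX; clear; lra.
    by move: hX hY; clear; lra.
  + by move=> hX hY; exfalso; move: hX hY; move: x1 z0; clear; lra.
  + by move=> hX hY; exfalso; move: hX hY; move: x0 y0 t0; clear; lra.
  + by move=> hX hY; exfalso; move: hX hY; move: x1 t0; clear; lra.
  + have /andP[q0 q1] := diag_param01 kr t01.
    by move=> hX hY; exfalso; move: hX hY; move: (_ / r%:R) q0 x1 => q; clear; lra.
  + by move=> hX hY; exfalso; move: hX hY; move: x0 z1; clear; lra.
  + move=> hX hY; have [||-> ->] := drawing_noncross D dab dab' s01 t01; last by [].
      by move: hX; clear; lra.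
    by move: hX hY; clear; lra.
  + by move=> hX hY; exfalso; move: hX hY; move: x0 t1; clear; lra.
  + by move=> hX hY; exfalso; move: hX hY; move: x1 y0 t1; clear; lra.
  + have /andP[q0 q1] := diag_param01 kr t01.
    by move=> hX hY; exfalso; move: hX hY; move: (_ / r%:R) q1 x0 => q; clear; lra.
  + by move=> hX hY; exfalso; move: hX hY; move: z0 w0 s0; clear; lra.
  + by move=> hX hY; exfalso; move: hX hY; move: z0 s1; clear; lra.
  + by [].
  + by move=> hX hY; exfalso; move: hX hY; move: s0 t1; clear; lra.
  + by move=> hX hY; exfalso; move: hX hY; move: (_ / r%:R) s1 => q; clear; lra.
  + by move=> hX hY; exfalso; move: hX hY; move: z1 s0; clear; lra.
  + by move=> hX hY; exfalso; move: hX hY; move: z1 w0 s1; clear; lra.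
  + by move=> hX hY; exfalso; move: hX hY; move: t0 s1; clear; lra.
  + by [].
  + by move=> hX hY; exfalso; move: hX hY; move: (_ / r%:R) s0 => q; clear; lra.
  + have /andP[q0 q1] := diag_param01 ir s01.
    by move=> hX hY; exfalso; move: hX hY; move: (_ / r%:R) q0 z1 => q; clear; lra.
  + have /andP[q0 q1] := diag_param01 ir s01.
    by move=> hX hY; exfalso; move: hX hY; move: (_ / r%:R) q1 z0 => q; clear; lra.
  + by move=> hX hY; exfalso; move: hX hY; move: (_ / r%:R) t1 => q; clear; lra.
  + by move=> hX hY; exfalso; move: hX hY; move: (_ / r%:R) t0 => q; clear; lra.
  + move=> hX _; have e : i%:R + s = k%:R + t.
      by apply: (mulIf rV); move: hX; clear; lra.
    by have -> : i = k by apply: diag_index e; rewrite ?(ltW s0) ?(ltW t0).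
Qed.
End Drawing.

(** * A path between the poles, and labels in the projective cube *)

(** Crossing the left copy and then taking the plain side [diag 0] -- [snk] makes the path one
    longer at each step; the pole edge finally closes it into a shortest odd cycle. *)
Lemma blowup_path r (I : finType) (d : rel (bool + I)) s :
  path d src s -> last src s = snk ->
  path (blowup (r := r) d) src (rcons (map (@lft r I) s) snk).
Proof.
move=> ds ls; rewrite rcons_path -[X in path _ X]/(lft r src) path_map.
rewrite -[X in last X]/(lft r src) last_map ls.
rewrite (sub_path _ ds) => [|a b dab]; last exact/blowupP/BlowupLft.
exact/blowupP/BlowupSnk.
Qed.

(* Adjacency in the projective cube of dimension [M]; the second alternative is
   that of the special edges. *)
Definition pc_adjacent (M : nat) (f g : nat -> bool) : Prop :=
  (exists2 c, c < M & forall i, i < M -> f i (+) g i = (i == c)) \/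
  (forall i, i < M -> f i (+) g i).

Lemma pc_adjacentC M f g : pc_adjacent M f g -> pc_adjacent M g f.
Proof.
case=> [[c cM fg]|fg]; [left; exists c => // i iM|right=> i iM].
  by rewrite addbC fg.
by rewrite addbC fg.
Qed.

(** The poles are labelled like the ends of a plain path of length [r] that flips each coordinate
    below [r] once. A step lowers [r] and raises [m] by one, keeping the dimension. *)
Record labelling (r m : nat) (I : finType) (d : rel (bool + I))
    (lab : bool + I -> nat -> bool) : Prop := Labelling {
  labelling_src : forall i, lab src i = false;
  labelling_snk : forall i, lab snk i = (i < r);
  labelling_edge : forall u v, d u v -> pc_adjacent (r + m) (lab u) (lab v)
}.

(** Viewed as sets, the labels along the path shrink from {0, ..., r} to {r}, its [i]-th edge
    dropping [i]. The left copy keeps its labels; flipping coordinate [r] in the right one gives its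
    poles the labels {r} and {0, ..., r - 1}. *)
Definition blowup_label r (I : finType) (lab : bool + I -> nat -> bool)
    (v : bool + inner r I) (c : nat) : bool :=
  match v with
  | inl b => b && (c < r)
  | inr (inl i) => i <= c <= r
  | inr (inr (inl i)) => lab (inr i) c
  | inr (inr (inr i)) => (c == r) (+) lab (inr i) c
  end.

Lemma labelling_blowup r m (I : finType) (d : rel (bool + I)) lab :
  labelling r.+1 m d lab ->
  labelling r m.+1 (blowup (r := r) d) (blowup_label (r := r) lab).
Proof.
move=> L; set lab' := blowup_label lab.
have labD i c : i <= r -> lab' (diag r I i) c = (i <= c <= r).
  by move=> ir; rewrite /lab' /= inordK.
have labL a c : lab' (lft r a) c = lab a c.
  case: a => [[]|i] //; last by rewrite (labelling_src L).
  by rewrite [LHS]labD // (labelling_snk L).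
have labR a c : lab' (rgt r a) c = (c == r) (+) lab a c.
  case: a => [[]|i] //; last first.
    by rewrite [LHS]labD // (labelling_src L) addbF eq_sym -eqn_leq eq_sym.
  by rewrite [LHS]/lab' /= (labelling_snk L) ltnS; case: ltngtP.
split=> // u v /blowupP[a b /(labelling_edge L)|a b /(labelling_edge L)|||i ir].
- by rewrite addSnnS => -[[c cM ab]|ab]; [left; exists c => //|right] => i iM;
    rewrite !labL ab.
- by rewrite addSnnS => -[[c cM ab]|ab]; [left; exists c => //|right] => i iM;
    rewrite !labR addbACA addbb addFb ab.
(* Both plain sides flip coordinate [r]. *)
- by left; exists r => [|i _]; [lia|rewrite labD //= -eqn_leq eq_sym].
- left; exists r => [|i _]; first lia.
  by rewrite labD //=; case: ltngtP.
- left; exists i => [|c _]; first lia.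
  rewrite !labD ?(ltnW ir) //; lia.
Qed.

(* With [M] even, an odd closed walk has an odd number of special edges, so each
   of the [M] coordinates must also be flipped by a plain edge. *)
Lemma pc_odd_cycle M (T : Type) (e : rel T) (lab : T -> nat -> bool) c :
  ~~ odd M -> (forall u v, e u v -> pc_adjacent M (lab u) (lab v)) ->
  cycle e c -> odd (size c) -> M < size c.
Proof.
move=> evM adj.
(* Here [j] counts the special edges and [b i] the plain edges flipping coordinate [i]. *)
have count x s : path e x s -> exists j (b : nat -> nat),
    size s = j + \sum_(i < M) b i /\
    forall i, i < M -> lab x i (+) lab (last x s) i = odd (j + b i).
  elim: s x => [|y s IH] x /=.
    by move=> _; exists 0, (fun=> 0); rewrite big1 //; split=> // i _; rewrite addbb.
  case/andP=> /adj exy /IH[j [b [sz par]]]; case: exy => [[k kM xy]|xy].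
    exists j, (fun i => (i == k) + b i); split=> [|i iM].
      have -> : \sum_(i < M) ((val i == k) + b i) = 1 + \sum_(i < M) b i.
        rewrite big_split /= (bigD1 (Ordinal kM)) //= eqxx big1 // => i.
        by rewrite -val_eqE /= => /negPf->.
      by rewrite sz; lia.
    have -> : lab x i = (i == k) (+) lab y i.
      by rewrite -(xy i iM) -addbA addbb addbF.
    by rewrite -addbA par // !oddD oddb addbCA.
  exists j.+1, b; split=> [|i iM]; first by rewrite sz.
  have -> : lab x i = true (+) lab y i by rewrite -(xy i iM) -addbA addbb addbF.
  by rewrite -addbA par // addSn oddS.
case: c => [|x s] // /count[j [b [sz par]]] odd_s.
have {}par i : i < M -> odd (j + b i) = false.
  by move=> iM; rewrite -par // last_rcons addbb.
(* Each [b i] has the parity of [j], so their sum over the even number [M] of coordinates is even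
   and [j] is odd. *)
have odd_b (N : nat) : N <= M -> odd (\sum_(i < N) b i) = odd N && odd j.
  elim: N => [|N IH] NM; first by rewrite big_ord0.
  rewrite big_ord_recr /= oddD IH ?(ltnW NM) //.
  have := par _ NM; rewrite oddD.
  by case: (odd j); case: (odd (b N)); case: (odd N).
have {}sz : size (x :: s) = j + \sum_(i < M) b i by rewrite -sz size_rcons.
have odd_j : odd j.
  by move: odd_s; rewrite sz oddD odd_b // (negPf evM) addbF.
have b1 i : i < M -> 0 < b i.
  by move=> /par; rewrite oddD odd_j; case: (b i).
have : \sum_(i < M) 1 <= \sum_(i < M) b i by apply: leq_sum => i _; apply: b1.
by rewrite sum1_card card_ord sz; case: j odd_j {sz par odd_b b1} => // j _; lia.
Qed.

(** * Short odd walks between the special edges *)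

Definition walk (T : Type) (E : rel T) (n : nat) (x y : T) : Prop :=
  exists s, [/\ size s = n, path E x s & last x s = y].

Lemma walk0 (T : Type) (E : rel T) x : walk E 0 x x.
Proof. by exists [::]. Qed.

Lemma walk1 (T : Type) (E : rel T) x y : E x y -> walk E 1 x y.
Proof. by move=> xy; exists [:: y]; rewrite /= xy. Qed.

Lemma walk_trans (T : Type) (E : rel T) m n x y z :
  walk E m x y -> walk E n y z -> walk E (m + n) x z.
Proof.
case=> s [<- xs <-] [t [<- st <-]]; exists (s ++ t).
by rewrite size_cat cat_path xs st last_cat.
Qed.

Lemma walk_sym (T : Type) (E : rel T) n x y :
  symmetric E -> walk E n x y -> walk E n y x.
Proof.
move=> sE [s [<- xs <-]]; exists (rev (belast x s)); split.
- by rewrite size_rev size_belast.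
- by rewrite -(eq_path (fun u v => sE v u)) rev_path.
- by case: s {xs} => //= z s; rewrite rev_cons last_rcons.
Qed.

Lemma walk_map (T U : Type) (E : rel T) (F : rel U) (f : T -> U) n x y :
  (forall u v, E u v -> F (f u) (f v)) -> walk E n x y -> walk F n (f x) (f y).
Proof.
move=> EF [s [<- xs <-]]; exists (map f s); rewrite size_map last_map path_map.
by split=> //; apply: sub_path xs.
Qed.

(** Going back and forth along the first edge adds 2 to the length, whence [0 < m]. *)
Lemma walk_extend (T : Type) (E : rel T) m n x y :
  symmetric E -> walk E m x y -> 0 < m <= n -> odd m = odd n -> walk E n x y.
Proof.
move=> sE w /andP[m0 mn] par; have -> : n = m + (n - m)./2.*2.
  have : ~~ odd (n - m) by rewrite oddB // par addbb.
  lia.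
elim: (_./2) => [|j IH]; first by rewrite addn0.
have [[|z s] [sz xs ls]] := IH; first by move: sz => /=; lia.
move: xs => /= /andP[xz zs].
have -> : m + j.+1.*2 = 2 + (m + j.*2) by lia.
apply: walk_trans IH; exists [:: z; x]; by rewrite /= xz sE xz.
Qed.

Lemma walk_diag r (I : finType) (d : rel (bool + I)) :
  walk (blowup (r := r) d) r (diag r I 0) (diag r I r).
Proof.
suff H n : n <= r -> walk (blowup (r := r) d) n (diag r I 0) (diag r I n).
  exact: H.
elim: n => [|n IH] nr; first exact: walk0.
rewrite -[X in walk _ X]addn1; apply: walk_trans (IH (ltnW nr)) _.
exact/walk1/blowupP/BlowupDiag.
Qed.

(* [K] indexes the special edges [ter (false, k) -- ter (true, k)].  The graph
   is used inside a larger one through [h], which supplies a further walk of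
   length [r] between the poles. *)
Record linked (r m : nat) (I : finType) (d : rel (bool + I)) (K : finType)
    (ter : bool * K -> bool + I) : Prop := Linked {
  linked_inj : injective ter;
  linked_walk : forall k (T : Type) (E : rel T) (h : bool + I -> T),
    symmetric E -> (forall u v, d u v -> E (h u) (h v)) ->
    exists2 A, A <= m & [/\ walk E A (h src) (h (ter (false, k))),
      walk E (m - A) (h snk) (h (ter (true, k)))
    & walk E 1 (h (ter (false, k))) (h (ter (true, k)))];
  linked_odd : forall (T : Type) (E : rel T) (h : bool + I -> T),
    symmetric E -> (forall u v, d u v -> E (h u) (h v)) ->
    walk E r (h src) (h snk) -> ~~ odd (r + m) ->
    forall w w', w != w' -> exists2 L,
      odd L && (L < r + m) & walk E L (h (ter w)) (h (ter w'))
}.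

Definition blowup_ter r (I K : finType) (ter : bool * K -> bool + I)
    (w : bool * (K + K)) : bool + inner r I :=
  match w.2 with
  | inl k => lft r (ter (w.1, k))
  | inr k => rgt r (ter (w.1, k))
  end.

(** Inside one copy the hypothesis for [r.+1] applies, its outside walk consisting of a plain side
    of the 4-cycle and the diagonal path. Different copies are joined through the corners. *)
Lemma linked_blowup r m (I : finType) (d : rel (bool + I)) (K : finType) ter :
  0 < r -> linked (K := K) r.+1 m d ter ->
  linked r m.+1 (blowup (r := r) d) (blowup_ter r ter).
Proof.
move=> r0 L.
have ED (i j : nat) : i <= r -> j <= r -> diag r I i = diag r I j -> i = j.
  by move=> ir jr [] /(congr1 val); rewrite /= !inordK.
split.
- have lI : injective (@lft r I).
    by move=> [[]|i] [[]|j] //= [->].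
  have rI : injective (@rgt r I).
    by move=> [[]|i] [[]|j] //= [->].
  have lr a b : lft r a <> rgt r b :> bool + inner r I.
    case: a b => [[]|i] [[]|j] //= /(ED 0 r (leq0n _) (leqnn _)); lia.
  move=> [b [k|k]] [b' [k'|k']]; rewrite /blowup_ter /=.
  + by move/lI/(linked_inj L) => [-> ->].
  + by move/lr.
  + by move/esym/lr.
  + by move/rI/(linked_inj L) => [-> ->].
- move=> k T E h sE hE.
  have hL u v : d u v -> E (h (lft r u)) (h (lft r v)).
    by move=> duv; apply/hE/blowupP/BlowupLft.
  have hR u v : d u v -> E (h (rgt r u)) (h (rgt r v)).
    by move=> duv; apply/hE/blowupP/BlowupRgt.
  (* The pole outside the copy reaches it by a plain side, which uses up the extra unit of [m.+1]:
     on the [snk] end for the left copy, on the [src] end for the right one. *)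
  case: k => k.
  + have [A Am [w0 w1 w01]] := linked_walk L k (h := h \o @lft r I) sE hL.
    exists A; first lia.
    split=> //; rewrite subSn // -add1n; apply: walk_trans w1.
    by apply/walk1; rewrite sE; apply/hE/blowupP/BlowupSnk.
  + have [A Am [w0 w1 w01]] := linked_walk L k (h := h \o @rgt r I) sE hR.
    exists A.+1; first lia.
    split=> //; rewrite ?subSS //; rewrite -add1n; apply: walk_trans w0.
    by apply/walk1/hE/blowupP/BlowupSrc.
move=> T E h sE hE ext par.
have hL u v : d u v -> E (h (lft r u)) (h (lft r v)).
  by move=> duv; apply/hE/blowupP/BlowupLft.
have hR u v : d u v -> E (h (rgt r u)) (h (rgt r v)).
  by move=> duv; apply/hE/blowupP/BlowupRgt.
have hs : walk E 1 (h src) (h (diag r I r)).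
  exact/walk1/hE/blowupP/BlowupSrc.
have ht : walk E 1 (h (diag r I 0)) (h snk).
  exact/walk1/hE/blowupP/BlowupSnk.
have hd : walk E r (h (diag r I 0)) (h (diag r I r)).
  exact: walk_map (walk_diag r d).
have cross b b' k k' : exists2 n, odd n && (n < r + m.+1) &
    walk E n (h (lft r (ter (b, k)))) (h (rgt r (ter (b', k')))).
  have [A Am [u0 u1 u01]] := linked_walk L k (h := h \o @lft r I) sE hL.
  have [B Bm [v0 v1 v01]] := linked_walk L k' (h := h \o @rgt r I) sE hR.
  set x := fun b => h (lft r (ter (b, k))).
  set y := fun b => h (rgt r (ter (b, k'))).
  have w00 : walk E (A + (1 + B)) (x false) (y false).
    by apply: walk_trans (walk_sym sE u0) (walk_trans hs v0).
  have w11 : walk E ((m - A) + (1 + (m - B))) (x true) (y true).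
    by apply: walk_trans (walk_sym sE u1) (walk_trans ht v1).
  have w01 : walk E (A + (r + (m - B))) (x false) (y true).
    by apply: walk_trans (walk_sym sE u0) (walk_trans ext v1).
  have w10 : walk E ((m - A) + (r + B)) (x true) (y false).
    by apply: walk_trans (walk_sym sE u1) (walk_trans hd v0).
  have ux c : walk E 1 (x c) (x (~~ c)) by case: c => //; apply: walk_sym.
  have vy c : walk E 1 (y (~~ c)) (y c) by case: c => //; apply: walk_sym.
  pose D c c' := match c, c' with
    | false, false => A + (1 + B) | true, true => (m - A) + (1 + (m - B))
    | false, true => A + (r + (m - B)) | true, false => (m - A) + (r + B) end.
  have wD c c' : walk E (D c c') (x c) (y c') by case: c; case: c'.
  have wD1 c c' : walk E (1 + D (~~ c) c') (x c) (y c').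
    exact: walk_trans (ux c) (wD _ _).
  have wD2 c c' : walk E (D c (~~ c') + 1) (x c) (y c').
    exact: walk_trans (wD _ _) (vy c').
  have wD3 c c' : walk E (1 + (D (~~ c) (~~ c') + 1)) (x c) (y c').
    exact: walk_trans (ux c) (walk_trans (wD _ _) (vy c')).
  (* As [r + m] is odd, all four values of [D] have the parity of [A + B + 1]. If odd, the
     candidates use no or two special edges; if even, either candidate uses one. The two candidates
     are odd with sum [2m + 4] or [2m + 2r + 2], at most [2(r + m + 1)] since [0 < r]; as
     [r + m + 1] is even, the smaller lies strictly below it. *)
  have : [|| odd (D b b') && (D b b' < r + m.+1),
    odd (1 + D (~~ b) b') && (1 + D (~~ b) b' < r + m.+1),
    odd (D b (~~ b') + 1) && (D b (~~ b') + 1 < r + m.+1) |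
    odd (1 + (D (~~ b) (~~ b') + 1)) && (1 + (D (~~ b) (~~ b') + 1) < r + m.+1)].
    by clear -Am Bm par r0; case: b; case: b' => /=; lia.
  by case/or4P => P; (eexists; first exact: P); auto.
have ext1 : walk E r.+1 (h (lft r src)) (h (lft r snk)).
  by rewrite -add1n; apply: walk_trans hs (walk_sym sE hd).
have ext2 : walk E r.+1 (h (rgt r src)) (h (rgt r snk)).
  by rewrite -addn1; apply: walk_trans (walk_sym sE hd) ht.
have par' : ~~ odd (r.+1 + m) by rewrite addSnnS.
move=> [b [k|k]] [b' [k'|k']]; rewrite /blowup_ter /= => ww'.
- rewrite -addSnnS; apply: (linked_odd L (h := h \o @lft r I) sE hL ext1 par').
  by apply: contraNneq ww' => -[-> ->].
- exact: cross.
- by have [n ? w] := cross b' b k' k; exists n => //; apply: walk_sym.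
- rewrite -addSnnS; apply: (linked_odd L (h := h \o @rgt r I) sE hR ext2 par').
  by apply: contraNneq ww' => -[-> ->].
Qed.

(** Induction on the number [m] of steps, for all [r] at once: a step glues two gadgets for
    [r.+1]. *)
Lemma gadget (R : realFieldType) m r : 0 < r ->
  exists (I : finType) (d : rel (bool + I)),
    [/\ exists X Y : bool + I -> R, drawing d X Y,
        exists lab, labelling r m d lab,
        exists2 s, size s = m.+1 & path d src s /\ last src s = snk
      & exists (K : finType) (ter : bool * K -> bool + I),
          #|K| = 2 ^ m /\ linked r m d ter].
Proof.
elim: m r => [|m IH] r r0.
  exists void, (fun u v => (u == src) && (v == snk)); split.
  - by do 2 eexists; apply: drawing_edge_graph.
  - exists (fun v i => (v == snk) && (i < r)); split=> // u v /andP[/eqP-> /eqP->].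
    by right=> i; rewrite addn0.
  - by exists [:: snk].
  exists unit, (fun w => inl w.1); split; first by rewrite card_unit.
  split=> [[b []] [b' []] [->] //|[] T E h sE dE|T E h sE dE ext par w w' ww'].
    by exists 0 => //; split; [exact: walk0|exact: walk0|apply/walk1/dE].
  (* Here [r] is even and positive, so the special edge alone is short enough. *)
  exists 1; first by case: r r0 ext par => [|[|r]].
  have st : E (h src) (h snk) by apply: dE.
  by case: w w' ww' => [[] []] [[] []] //= _; apply: walk1; rewrite // sE.
have [I [d [[X [Y D]] [lab L] [s sz [ds ls]] [K [ter [cK kT]]]]]] := IH r.+1 isT.
exists (inner r I), (blowup (r := r) d); split.
- by exists (blowupX (r := r) X), (blowupY (r := r) X Y); apply: drawing_blowup.
- by exists (blowup_label (r := r) lab); apply: labelling_blowup.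
- exists (rcons (map (@lft r I) s) snk); first by rewrite size_rcons size_map sz.
  by rewrite last_rcons; split=> //; apply: blowup_path.
exists (K + K)%type, (blowup_ter r ter); split; last exact: linked_blowup.
by rewrite card_sum cK expnS mul2n addnn.
Qed.

(** * Adding the edge between the poles *)

(** The added edge is the initial plain one; it serves as the outside walk of length 1 required by
    [linked]. *)
Definition oriented (I : finType) (d : rel (bool + I)) : rel (bool + I) :=
  fun u v => d u v || (u == src) && (v == snk).

Definition close_poles (I : finType) (d : rel (bool + I)) : rel (bool + I) :=
  fun u v => oriented d u v || oriented d v u.

Lemma close_polesC (I : finType) (d : rel (bool + I)) : symmetric (close_poles d).
Proof. by move=> u v; rewrite /close_poles orbC. Qed.

Lemma oriented_mono (R : realFieldType) (I : finType) (d : rel (bool + I))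
    (X Y : bool + I -> R) u v : drawing d X Y -> oriented d u v -> (X u < X v)%R.
Proof.
move=> D /orP[/(drawing_mono D)//|/andP[/eqP-> /eqP->]].
by rewrite (drawing_src D).1 (drawing_snk D).1 ltr01.
Qed.

(** * Planarity of the closed graph *)

Section Planarity.
Local Open Scope ring_scope.
Local Open Scope classical_set_scope.

(* The pole edge is drawn as a parabola passing below the rhombus. *)
Definition edge_arc (I : finType) (X Y : bool + I -> R) (u v : bool + I)
    (t : R) : R * R :=
  (seg (X u) (X v) t,
   if (u == src) && (v == snk) then 3 * (t * (t - 1)) else seg (Y u) (Y v) t).

Lemma seg_continuous (a b : R) : continuous (seg a b).
Proof.
move=> t; rewrite /seg; apply: cvgD; apply: cvgM; try exact: cvg_cst.
  by apply: cvgB; [exact: cvg_cst|exact: cvg_id].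
exact: cvg_id.
Qed.

Lemma edge_arc_continuous (I : finType) (X Y : bool + I -> R) u v :
  continuous (edge_arc X Y u v).
Proof.
have arcc (f g : R -> R) : continuous f -> continuous g ->
    continuous (fun t => (f t, g t)).
  by move=> fc gc t; exact: (cvg_pair (fc t) (gc t)).
apply: arcc; first exact: seg_continuous.
case: (_ && _); last exact: seg_continuous.
move=> t; apply: cvgM; first exact: cvg_cst.
apply: cvgM; first exact: cvg_id.
by apply: cvgB; [exact: cvg_id|exact: cvg_cst].
Qed.

(** Otherwise [3 * (1 - t) <= 1] and [3 * t <= 1], which add up to 3 <= 2; any factor above 2 would
    do. *)
Lemma parabola_below (t y : R) : 0 < t < 1 ->
  y = 3 * (t * (t - 1)) -> `|y| <= t -> `|y| <= 1 - t -> False.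
Proof.
move=> /andP[t0 t1] ->; rewrite -normrN -2!mulrN opprB ger0_norm; last first.
  by rewrite !mulr_ge0 ?subr_ge0 ?ltW.
have t1' : 0 < 1 - t by rewrite subr_gt0.
move=> h1 h2.
have : 3 * (1 - t) <= 1 by rewrite -(ler_pM2l t0) mulr1 mulrCA.
have : 3 * t <= 1 by rewrite -(ler_pM2r t1') mul1r -mulrA.
lra.
Qed.

Lemma edge_arc_avoid (I : finType) (d : rel (bool + I)) (X Y : bool + I -> R)
    u v w t :
  drawing d X Y -> oriented d u v -> 0 < t < 1 -> edge_arc X Y u v t <> (X w, Y w).
Proof.
move=> D ouv t01; rewrite /edge_arc; case: ifP ouv => [/andP[/eqP-> /eqP->] _|uv].
  rewrite (drawing_src D).1 (drawing_snk D).1 => -[hX hY].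
  have [] := drawing_rhombus D w; rewrite -hY -hX /seg mulr0 add0r mulr1.
  exact: parabola_below.
by rewrite /oriented uv orbF => duv -[]; exact: (drawing_avoid D duv t01).
Qed.

Lemma edge_arc_noncross (I : finType) (d : rel (bool + I)) (X Y : bool + I -> R)
    u v u' v' s t :
  drawing d X Y -> oriented d u v -> oriented d u' v' -> 0 < s < 1 -> 0 < t < 1 ->
  edge_arc X Y u v s = edge_arc X Y u' v' t -> u = u' /\ v = v'.
Proof.
move=> D ouv ouv' s01 t01.
have x0 := (drawing_src D).1; have x1 := (drawing_snk D).1.
rewrite /edge_arc; case: ifP ouv => [/andP[/eqP-> /eqP->] _|uv];
  case: ifP ouv' => [/andP[/eqP-> /eqP->] _|uv'] //.
- rewrite /oriented uv' orbF x0 x1 => duv' [hX hY].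
  have [_] := drawing_edge D duv' t01.
  by rewrite -hX -hY /seg mulr0 add0r mulr1 => /parabola_below h /h [].
- rewrite /oriented uv orbF x0 x1 => duv [hX hY].
  have [_] := drawing_edge D duv s01.
  by rewrite hX hY /seg mulr0 add0r mulr1 => /parabola_below h /h [].
rewrite /oriented uv uv' !orbF => duv' duv [].
exact: (drawing_noncross D duv duv' s01 t01).
Qed.

Lemma planar_close_poles (I : finType) (d : rel (bool + I)) (X Y : bool + I -> R) :
  drawing d X Y -> planar (close_poles d).
Proof.
move=> D; have flip (t : R) : 0 < t < 1 -> 0 < 1 - t < 1 by move=> ?; lra.
have flipc : continuous (fun t : R => 1 - t).
  have -> : (fun t : R => 1 - t) = seg 1 0.
    by apply/funext => t; rewrite /seg mulr1 mulr0 addr0.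
  exact: seg_continuous.
(* An edge taken against its orientation gets the reversed arc. *)
pose a u v t :=
  if oriented d u v then edge_arc X Y u v t else edge_arc X Y v u (1 - t).
have end0 u v : oriented d u v -> edge_arc X Y u v 0 = (X u, Y u).
  rewrite /edge_arc /seg => _; rewrite !mul0r !subr0 !mul1r !addr0.
  by case: ifP => // /andP[/eqP-> _]; rewrite mulr0 (drawing_src D).2.
have end1 u v : oriented d u v -> edge_arc X Y u v 1 = (X v, Y v).
  rewrite /edge_arc /seg => _; rewrite !subrr !mul0r !mul1r !add0r.
  by case: ifP => // /andP[_ /eqP->]; rewrite !mulr0 (drawing_snk D).2.
(* The abscissa is affine and strictly increasing along every arc, the parabola included. *)
have inj u v : oriented d u v -> injective (edge_arc X Y u v).
  move=> /(oriented_mono D) uv s t [+ _]; rewrite /seg => e.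
  have : (s - t) * (X v - X u) = 0 by lra.
  by move/eqP; rewrite mulf_eq0 !subr_eq0 (gt_eqF uv) orbF => /eqP.
exists (fun v => (X v, Y v)), a; split.
  by move=> u v [hX hY]; exact: (drawing_inj D hX hY).
split; [|split].
- move=> u v; rewrite /close_poles /a; case: ifP => [ouv _|_ /= ovu].
    split; first by apply: continuous_subspaceT; apply: edge_arc_continuous.
    split; first by move=> s t _ _; apply: inj.
    by rewrite end0 // end1.
  split.
    apply: continuous_subspaceT => t.
    exact: (continuous_comp (flipc t) (@edge_arc_continuous I X Y v u _)).
  split; first by move=> s t _ _ /(inj _ _ ovu)/addrI/oppr_inj.
  have -> : (1 - 0 : R) = 1 by exact: subr0.
  have -> : (1 - 1 : R) = 0 by exact: subrr.
  by rewrite end0 // end1.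
- move=> u v + t t01 w; rewrite /close_poles /a; case: ifP => [ouv _|_ /= ovu].
    exact: (edge_arc_avoid D ouv t01).
  exact: (edge_arc_avoid D ovu (flip _ t01)).
move=> x y u v + + ne s t s01 t01; rewrite /close_poles /a.
case: ifP => [oxy _|_ /= oyx]; case: ifP => [ouv _|_ /= ovu].
- by move=> /(edge_arc_noncross D oxy ouv s01 t01)[xu yv]; apply: ne; left.
- by move=> /(edge_arc_noncross D oxy ovu s01 (flip _ t01))[xv yu]; apply: ne; right.
- by move=> /(edge_arc_noncross D oyx ouv (flip _ s01) t01)[yu xv]; apply: ne; right.
- move=> /(edge_arc_noncross D oyx ovu (flip _ s01) (flip _ t01))[yv xu].
  by apply: ne; left.
Qed.

End Planarity.

(** * Odd girth and clique number of the closed graph *)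

Lemma simple_close_poles (R : realFieldType) (I : finType) (d : rel (bool + I))
    (X Y : bool + I -> R) : drawing d X Y -> simple_graph (close_poles d).
Proof.
move=> D; split; first exact: close_polesC.
move=> u; apply/negP; rewrite /close_poles orbb => /(oriented_mono D).
by rewrite ltxx.
Qed.

Lemma odd_girth_close_poles (R : realFieldType) m (I : finType) (d : rel (bool + I))
    (X Y : bool + I -> R) lab s :
  odd m -> drawing d X Y -> labelling 1 m d lab ->
  path d src s -> last src s = snk -> size s = m.+1 ->
  has_odd_girth (close_poles d) m.+2.
Proof.
move=> odd_m D L ds ls sz.
have ev : ~~ odd (1 + m) by rewrite add1n /= odd_m.
have adj u v : oriented d u v -> pc_adjacent (1 + m) (lab u) (lab v).
  case/orP=> [/(labelling_edge L)//|/andP[/eqP-> /eqP->]].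
  (* With [r = 1] the poles differ in coordinate 0 only, so the pole edge is a plain edge of the
     cube. *)
  by left; exists 0 => // i _; rewrite (labelling_src L) (labelling_snk L); case: i.
split; first by rewrite /= negbK.
split=> [|c /and3P[_ _ cy] odd_c]; last first.
  apply: (pc_odd_cycle (lab := lab) ev _ cy odd_c) => u v /orP[/adj//|/adj].
  exact: pc_adjacentC.
(* The abscissa strictly increases along the path, so no vertex repeats. *)
have us : uniq (src :: s).
  apply: (@sorted_uniq _ (fun u v => X u < X v)%R).
  - by move=> y x z; apply: lt_trans.
  - by move=> x; apply: ltxx.
  - by apply: sub_path ds => u v; apply: (drawing_mono D).
exists (src :: s); split; last by rewrite /= sz.
apply/and3P; split=> //.
  by rewrite /= sz; case: m odd_m {sz L ev adj}.
rewrite /cycle rcons_path ls /close_poles /oriented !eqxx !orbT andbT.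
by apply: sub_path ds => u v duv; rewrite duv.
Qed.

(** The ends of the special edges form the clique: an odd walk of length at most [m] joins any two
    of them and extends to length exactly [m], which is odd. *)
Lemma clique_close_poles m (I : finType) (d : rel (bool + I)) (K : finType) ter :
  odd m -> linked (K := K) 1 m d ter ->
  #|K|.*2 <= clique_number (walk_power (close_poles d) m).
Proof.
move=> odd_m L; have sC := @close_polesC I d.
have -> : #|K|.*2 = #|[set ter w | w in [set: bool * K]]|.
  by rewrite card_imset ?cardsT ?card_prod ?card_bool ?mul2n //; apply: linked_inj L.
apply: leq_bigmax_cond; apply/forallP => x; apply/implyP => /imsetP[w _ ->].
apply/forallP => y; apply/implyP => /imsetP[w' _ ->]; apply/implyP => ww'.
rewrite /walk_power ww' /=.
have dC u v : d u v -> close_poles d u v by rewrite /close_poles /oriented => ->.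
have poles : walk (close_poles d) 1 src snk.
  by apply: walk1; rewrite /close_poles /oriented !eqxx !orbT.
have ev : ~~ odd (1 + m) by rewrite add1n /= odd_m.
have [|n /andP[odd_n nm] wn] :=
  linked_odd L (h := id) sC dC poles ev (w := w) (w' := w').
  by apply: contraNneq ww' => ->.
have [|s [sz ps ls]] := walk_extend sC wn (n := m) _ (etrans odd_n (esym odd_m)).
  by rewrite odd_gt0.
by apply/existsP; exists (Tuple (introT eqP sz)); rewrite /= ps ls eqxx.
Qed.

Theorem theorem4 (k : nat) : (0 < k)%N ->
  exists (T : finType) (e : rel T),
    simple_graph e /\ planar e /\ has_odd_girth e (2 * k).+1 /\
    (2 ^ (2 * k) <= clique_number (walk_power e (2 * k - 1)))%N.
Proof.
move=> k0; set m := 2 * k - 1.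
have odd_m : odd m by rewrite /m; lia.
(* The outermost [r] is 1, the length of the pole edge. *)
have [I [d [[X [Y D]] [lab L] [s sz [ds ls]] [K [ter [cK kT]]]]]] :=
  gadget R m (ltn0Sn 0).
have mk : 2 * k = m.+1 by rewrite /m; lia.
exists (bool + I)%type, (close_poles d); split; first exact: simple_close_poles D.
split; first exact: planar_close_poles D.
split; first by rewrite mk; apply: odd_girth_close_poles D L ds ls sz.
by rewrite mk expnS mul2n -cK; apply: clique_close_poles kT.
Qed.
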